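(* Let $R$ be an integral domain. Then the ring of Laurent polynomials $R[x,x^{-1}]$ is hereditarily atomic if and only if $R$ is an algebraic extension of $\mathbb{F}_p$ for some prime $p$.
   Context: An integral domain is atomic if every nonzero nonunit element factors into (finitely many) irreducible elements. An integral domain $R$ is hereditarily atomic if every subring of $R$ (with the same identity) is atomic. *)

(* Defs.v *)
From HB Require Import structures.
From mathcomp Require Import all_boot all_order all_algebra.
From mathcomp Require Import boolp.

Set Implicit Arguments.
Unset Strict Implicit.
Unset Printing Implicit Defensive.

Import GRing.Theory.
Local Open Scope ring_scope.

(* A subring of D as an integral domain in its own right.  Membership is a
   boolean predicate; classically (boolp) every subset of D is of this form. *)
Section Subring.
Variables (D : idomainType) (S : subringClosed D).

Record subring := Subring { subring_val : D; subring_valP : subring_val \in S }.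

HB.instance Definition _ := [isSub for subring_val].
HB.instance Definition _ := [Choice of subring by <:].
HB.instance Definition _ := [SubChoice_isSubComNzRing of subring by <:].

(* u is a unit of S when it is invertible in D with its inverse lying in S. *)
Definition subring_unit : {pred subring} :=
  fun u => (val u \is a GRing.unit) && ((val u)^-1 \in S).

Definition subring_inv (u : subring) : subring :=
  if subring_unit u then insubd u (val u)^-1 else u.

Fact subring_mulVx : {in subring_unit, left_inverse 1 subring_inv *%R}.
Proof.
move=> u; rewrite -topredE /= => uU; apply: val_inj.
transitivity (val (subring_inv u) * val u); first exact: rmorphM.
have /andP[uD uS] := uU.
by rewrite /subring_inv uU val_insubd uS mulVr.
Qed.

Fact subring_unitPl (u v : subring) : v * u = 1 -> subring_unit u.
Proof.
move=> /(congr1 val) vu.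
have vu1 : val v * val u = 1 by exact: vu.
have uD : val u \is a GRing.unit.
  by apply/unitrP; exists (val v); split; rewrite // mulrC.
rewrite /subring_unit uD /=.
have -> : (val u)^-1 = val v by rewrite -[LHS]mul1r -vu1 mulrK.
exact: (valP v).
Qed.

Fact subring_inv_out : {in [predC subring_unit], subring_inv =1 id}.
Proof. by move=> u /negbTE uU; rewrite /subring_inv [subring_unit u]uU. Qed.

HB.instance Definition _ := GRing.ComNzRing_hasMulInverse.Build subring
  subring_mulVx subring_unitPl subring_inv_out.

Fact subring_integral : GRing.integral_domain_axiom subring.
Proof.
move=> u v /(congr1 val) uv.
have /eqP : val u * val v = 0 by exact: uv.
by rewrite mulf_eq0 -!(inj_eq val_inj).
Qed.

HB.instance Definition _ :=
  GRing.ComUnitRing_isIntegral.Build subring subring_integral.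

End Subring.

Definition irreducible (D : idomainType) (a : D) : Prop :=
  [/\ a != 0, a \isn't a GRing.unit
    & forall b c : D, a = b * c ->
        b \is a GRing.unit \/ c \is a GRing.unit].

Definition atomic (D : idomainType) : Prop :=
  forall a : D, a != 0 -> a \isn't a GRing.unit ->
    exists2 s : seq D, {in s, forall b, irreducible b} & a = \prod_(b <- s) b.

Definition hereditarily_atomic (D : idomainType) : Prop :=
  forall S : subringClosed D, atomic (subring S).

(* R[x, x^-1] is realized inside Frac(R[x]) as the fractions p / x^n. *)
Section Laurent.
Variable R : idomainType.

Local Notation "p %:F" := (@FracField.tofrac {poly R} p).

Definition laurent_pred : {pred {fraction {poly R}}} :=
  fun f => `[< exists (p : {poly R}) (n : nat), f = p%:F / ('X^n)%:F >].

Fact laurent_subring_closed : subring_closed laurent_pred.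
Proof.
have nz n : ('X^n)%:F != 0 by rewrite tofrac_eq0 monic_neq0 ?monicXn.
split.
- by apply/asboolP; exists 1, 0%N; rewrite expr0 divff ?tofrac_eq0 ?oner_eq0.
- move=> _ _ /asboolP[p [m ->]] /asboolP[q [n ->]]; apply/asboolP.
  exists (p * 'X^n - q * 'X^m), (m + n)%N.
  by rewrite exprD tofracB !tofracM -mulNr addf_div ?nz // mulNr.
- move=> _ _ /asboolP[p [m ->]] /asboolP[q [n ->]]; apply/asboolP.
  by exists (p * q), (m + n)%N; rewrite exprD !tofracM mulf_div.
Qed.

HB.instance Definition _ :=
  GRing.isSubringClosed.Build _ laurent_pred laurent_subring_closed.

Definition laurent : idomainType := subring laurent_pred.

End Laurent.

(* R is a field containing 'F_p, over which every element is algebraic.  The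
   last clause is [algebraicOver iota a] unfolded: the library states it only
   for a codomain bundled as a fieldType.  p is meant to be prime. *)
Definition algebraic_extension_Fp (R : idomainType) (p : nat) : Prop :=
  GRing.field_axiom R /\
  exists iota : {rmorphism 'F_p -> R}, forall a : R,
    exists2 q : {poly 'F_p}, q != 0 & root (map_poly iota q) a.

(* Main.v *)
From HB Require Import structures.
Require Import Defs.
From mathcomp Require Import all_boot all_order all_algebra all_field.
From mathcomp Require Import boolp classical_sets.
From mathcomp Require Import zify.

(** Both implications are about units.

    If R[x, x^-1] is hereditarily atomic, then every subring A of R is a field.
    Indeed, for t in A consider the ring S of the Laurent polynomials over A
    whose coefficients of negative degree are multiples of t.  Suppose t has no
    inverse in A.  A monomial c x^k of S with k < 0 is x times the monomial
    c x^(k-1) of S, and neither factor is a unit of S, so no monomial of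
    negative degree is irreducible.  But every factor of t x^-1 is a monomial,
    and one of them has negative degree, so t x^-1 is not a product of
    irreducibles ([polar_nonatomic]).  Taking for A the subrings generated by a
    single element gives the rest: that of Z.1 being a field forces positive
    characteristic p, and an inverse of a in Z[a] is a polynomial relation for
    a over F_p.

    Conversely, let R be algebraic over F_p and S a subring of R[x, x^-1].  All
    constants of R are integral over S.  If S contains some g <> 0 of negative
    degree, then g, read as a polynomial in x^-1, is nonconstant, so x^-1 is a
    root of a polynomial with invertible leading coefficient and integral
    coefficients: x^-1 is integral over S.  Now an element m of S whose inverse
    is integral over S is a unit of S, because m^-1 is then a polynomial in m
    over S.  Hence all the monomials c x^k of S with k >= 0 are units of S.
    Symmetrically, if S contains some g of positive order, the monomials of S
    with k <= 0 are units.  This yields an additive length that vanishes only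
    at units ([monomial_unit], [atomic_of_laurent_embedding]): the difference
    between degree and order, plus the degree if S has no element of negative
    degree, minus the order if S has no element of positive order.  A ring with
    such a length is atomic ([atomic_of_length]). *)

Set Implicit Arguments.
Unset Strict Implicit.
Unset Printing Implicit Defensive.

Import Order.TTheory GRing.Theory Num.Theory.
Local Open Scope ring_scope.

(** * Atomicity and integrality *)

Lemma atomic_of_length (D : idomainType) (l : D -> nat) :
    (forall a b, a != 0 -> b != 0 -> l (a * b) = (l a + l b)%N) ->
    (forall a, a != 0 -> l a = 0%N -> a \is a GRing.unit) ->
  atomic D.
Proof.
move=> lM lU a; have [n] := ubnP (l a); elim: n a => // n IHn a la_n a0 aNU.
have [irr_a | red_a] := pselect (irreducible a).
  by exists [:: a]; rewrite ?big_seq1 // => b; rewrite inE => /eqP->.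
have [b [c [abc bNU cNU]]] :
    exists b c, [/\ a = b * c, b \isn't a GRing.unit & c \isn't a GRing.unit].
  apply/not_existsP => noNU; case: red_a; split=> // b c abc.
  have [bU | bNU] := boolP (b \is a GRing.unit); first by left.
  have [cU | cNU] := boolP (c \is a GRing.unit); first by right.
  by case: (noNU b); exists c.
move: a0 la_n; rewrite abc mulf_eq0 negb_or => /andP[b0 c0].
have l_gt0 d : d != 0 -> d \isn't a GRing.unit -> (0 < l d)%N.
  by move=> d0; apply: contraNT; rewrite -eqn0Ngt => /eqP /(lU _ d0).
rewrite lM // => lbc_n.
have := l_gt0 _ b0 bNU; have := l_gt0 _ c0 cNU => lc_gt0 lb_gt0.
have [|s irr_s ->] := IHn b _ b0 bNU; first by lia.
have [|t irr_t ->] := IHn c _ c0 cNU; first by lia.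
by exists (s ++ t); rewrite ?big_cat // => d; rewrite mem_cat => /orP[/irr_s|/irr_t].
Qed.

(** Multiplying a monic equation of degree d for m^-1 by m^d expresses 1 as a
    multiple of m with a cofactor in D. *)
Lemma unit_of_integral_inverse (D : idomainType) (K : fieldType)
    (phi : {rmorphism D -> K}) (m : D) :
    injective phi -> m != 0 -> integralOver phi (phi m)^-1 ->
  m \is a GRing.unit.
Proof.
move=> phi_inj m0 [q q_mon]; have phim0 : phi m != 0.
  by rewrite -(rmorph0 phi) (inj_eq phi_inj).
have [d sz_q] : exists d, size q = d.+1.
  by exists (size q).-1; rewrite prednK // size_poly_gt0 monic_neq0.
move/rootP; rewrite (@horner_coef_wide _ d.+1) ?size_map_inj_poly ?rmorph0 ?sz_q //.
move/(congr1 (fun z => phi m ^+ d * z)); rewrite mulr0 mulr_sumr.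
pose r := \sum_(i < d) q`_i * m ^+ (d - i.+1).
have lead1 : (map_poly phi q)`_d = 1.
  rewrite coef_map (_ : q`_d = 1); first exact: rmorph1.
  by move/monicP: q_mon; rewrite lead_coefE sz_q.
rewrite big_ord_recr /= lead1 mul1r exprVn mulfV ?expf_neq0 //.
rewrite (eq_bigr (fun i : 'I_d => phi m * phi (q`_i * m ^+ (d - i.+1)))).
  rewrite -mulr_sumr -rmorph_sum -/r -rmorphM -(rmorph1 phi) -rmorphD -(rmorph0 phi).
  move/phi_inj/eqP; rewrite addr_eq0 -eqr_oppLR => /eqP mr.
  by apply/unitrP; exists (- r); rewrite mulrN mulNr (mulrC r) mr.
move=> i _; rewrite coef_map rmorphM rmorphXn mulrCA [RHS]mulrCA; congr (_ * _).
rewrite exprVn -[X in _ ^+ X * _](subnK (ltn_ord i)).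
rewrite addnS -addSn exprD mulfK ?expf_neq0 //; exact: exprS.
Qed.

Lemma integral_exp (R K : comNzRingType) (phi : {rmorphism R -> K}) (v : K) n :
  integralOver phi v -> integralOver phi (v ^+ n).
Proof.
move=> int_v; elim: n => [|n IHn]; first exact: integral1.
by rewrite exprS; apply: integral_mul.
Qed.

(** v is a root of r - phi b, which has the same leading coefficient as r because
    r is not constant; transitivity of integrality concludes. *)
Lemma integral_of_nonconstant_value (D : idomainType) (K : fieldType)
    (phi : {rmorphism D -> K}) (r : {poly K}) (v : K) (b : D) :
    (1 < size r)%N -> r.[v] = phi b ->
    (forall i, integralOver phi r`_i) ->
    integralOver phi (lead_coef r)^-1 ->
  integralOver phi v.
Proof.
move=> r_gt1 rv int_r int_lead; pose q := (lead_coef r)^-1 *: (r - (phi b)%:P).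
have sz_b : (size (- (phi b)%:P) < size r)%N.
  by rewrite size_polyN (leq_ltn_trans (size_polyC_leq1 _)).
have lead_r0 : lead_coef r != 0 by rewrite lead_coef_eq0 -size_poly_gt0 ltnW.
apply: (@integral_root_monic _ _ phi v q).
- by rewrite monicE lead_coefZ lead_coefDl // mulVf.
- by rewrite /root hornerZ hornerD hornerN hornerC rv subrr mulr0.
apply/integral_poly=> i; rewrite coefZ coefB coefC.
apply: integral_mul => //; apply: integral_sub => //.
by case: ifP => _; [apply: integral_id | apply: integral0].
Qed.

(** * Order and degree of Laurent polynomials *)

Section NormalForm.
Variable R : idomainType.
Local Notation E := {fraction {poly R}}.
Local Notation "p %:F" := (@FracField.tofrac {poly R} p).
Local Notation x := ('X%:F : E).

Lemma fracX_neq0 : x != 0. Proof. by rewrite tofrac_eq0 polyX_eq0. Qed.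
Hint Resolve fracX_neq0 : core.

Definition normal_form (f : E) (pk : {poly R} * int) : Prop :=
  pk.1`_0 != 0 /\ f = pk.1%:F * x ^ pk.2.

Lemma normal_form_exists f :
  f \in @laurent_pred R -> f != 0 -> exists pk, normal_form f pk.
Proof.
move=> /asboolP[p [n ->]] pX0.
have p0 : p != 0 by apply: contraNneq pX0 => ->; rewrite tofrac0 mul0r.
have [m [q]] := multiplicity_XsubC p 0; rewrite p0 /= subr0 => q0 ->.
exists (q, m%:Z - n%:Z); split=> /=; first by rewrite -horner_coef0.
by rewrite tofracM !tofracXn (expfzDr _ _ fracX_neq0) -exprnP -exprnN mulrA.
Qed.

Lemma normal_form_uniq f pk ql : normal_form f pk -> normal_form f ql -> pk = ql.
Proof.
wlog le_kl : pk ql / pk.2 <= ql.2.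
  move=> W fpk fql; case: (leP pk.2 ql.2) => [le_kl|/ltW le_lk]; first exact: W.
  by symmetry; apply: W.
case: pk ql le_kl => [p k] [q l] /= le_kl [/= p0 ->] [/= q0].
have [n ln] : exists n : nat, l = n%:Z + k by exists `|l - k|%N; lia.
rewrite ln expfzDr // mulrA -exprnP -tofracXn -tofracM => /mulIf.
rewrite expfz_neq0 // => /(_ isT) /eqP; rewrite tofrac_eq => /eqP pq.
move: p0; rewrite pq; case: n ln pq => [|n] _ _; rewrite ?mulr1 ?add0r //.
by rewrite coefMXn eqxx.
Qed.

Lemma normal_formM f g pk ql : normal_form f pk -> normal_form g ql ->
  normal_form (f * g) (pk.1 * ql.1, pk.2 + ql.2).
Proof.
move=> [p0 ->] [q0 ->]; split=> /=; first by rewrite coef0M mulf_neq0.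
by rewrite tofracM expfzDr // mulrACA.
Qed.

(** A junk value is returned when f is zero or not a Laurent polynomial. *)
Definition nform (f : E) : {poly R} * int := xget (0, 0) (normal_form f).

Lemma nform_eq f pk : normal_form f pk -> nform f = pk.
Proof.
by move=> fpk; apply: xget_unique => // ql fql; apply: normal_form_uniq fql fpk.
Qed.

Definition lord f : int := (nform f).2.
Definition lwidth f : nat := (size (nform f).1).-1.
Definition ldeg f : int := (lwidth f)%:Z + lord f.

Lemma ldegE f (p : {poly R}) k :
  nform f = (p, k) -> ldeg f = (size p).-1%:Z + k.
Proof. by rewrite /ldeg /lwidth /lord => ->. Qed.

Lemma nformP f :
  f \in @laurent_pred R -> f != 0 -> normal_form f (nform f).
Proof.
by move=> fL f0; have [pk fpk] := normal_form_exists fL f0; rewrite (nform_eq fpk).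
Qed.

Lemma nformM f g : f \in @laurent_pred R -> g \in @laurent_pred R ->
    f != 0 -> g != 0 ->
  nform (f * g) = ((nform f).1 * (nform g).1, (nform f).2 + (nform g).2).
Proof.
move=> fL gL f0 g0.
exact: nform_eq (normal_formM (nformP fL f0) (nformP gL g0)).
Qed.

Lemma lordM f g : f \in @laurent_pred R -> g \in @laurent_pred R ->
    f != 0 -> g != 0 -> lord (f * g) = lord f + lord g.
Proof. by move=> fL gL f0 g0; rewrite /lord nformM. Qed.

Lemma lwidthM f g : f \in @laurent_pred R -> g \in @laurent_pred R ->
    f != 0 -> g != 0 -> lwidth (f * g) = (lwidth f + lwidth g)%N.
Proof.
move=> fL gL f0 g0; rewrite /lwidth nformM //=.
have nz h : h \in @laurent_pred R -> h != 0 -> (nform h).1 != 0.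
  by move=> hL h0; have [+ _] := nformP hL h0; apply: contraNneq => ->; rewrite coef0.
have := nz f fL f0; have := nz g gL g0; rewrite -!size_poly_gt0 => sg sf.
by rewrite size_mul -?size_poly_gt0 //; move: sf sg; do 2!case: size => // ?; lia.
Qed.

Lemma ldegM f g : f \in @laurent_pred R -> g \in @laurent_pred R ->
    f != 0 -> g != 0 -> ldeg (f * g) = ldeg f + ldeg g.
Proof. by move=> fL gL f0 g0; rewrite /ldeg lordM ?lwidthM //; lia. Qed.

Lemma lwidth0_monomial f : f \in @laurent_pred R -> f != 0 -> lwidth f = 0%N ->
  exists2 c : R, c != 0 & f = c%:P%:F * x ^ lord f.
Proof.
move=> fL f0 w0; have [p0 fE] := nformP fL f0; exists (nform f).1`_0 => //.
by rewrite -size1_polyC // (leq_trans (leqSpred _)) // -[_.-1]/(lwidth f) w0.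
Qed.

End NormalForm.

Section LaurentVal.
Variables (R : idomainType) (S : subringClosed (laurent R)).
Local Notation E := {fraction {poly R}}.

Definition laurent_val : subring S -> E :=
  (val : laurent R -> E) \o (val : subring S -> laurent R).

HB.instance Definition _ := GRing.RMorphism.copy laurent_val
  ((val : laurent R -> E) \o (val : subring S -> laurent R)).

Lemma laurent_val_inj : injective laurent_val.
Proof. by move=> b c /val_inj /val_inj. Qed.

Lemma laurent_valM b c : laurent_val (b * c) = laurent_val b * laurent_val c.
Proof. exact: rmorphM. Qed.

Lemma laurent_val1 : laurent_val 1 = 1.
Proof. exact: rmorph1. Qed.

Lemma laurent_val_laurent b : laurent_val b \in @laurent_pred R.
Proof. exact: valP (val b). Qed.

Lemma laurent_val_neq0 b : b != 0 -> laurent_val b != 0.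
Proof. by rewrite -(inj_eq laurent_val_inj) rmorph0. Qed.

End LaurentVal.

(** * Domains of Laurent polynomials over which all constants are integral *)

Section IntegralConstants.
Variables (R D : idomainType) (phi : {rmorphism D -> {fraction {poly R}}}).
Local Notation "p %:F" := (@FracField.tofrac {poly R} p).
Local Notation x := ('X%:F : {fraction {poly R}}).
Local Notation fracX_neq0 := (fracX_neq0 R).
Hypothesis phi_inj : injective phi.
Hypothesis phiL : forall b, phi b \in @laurent_pred R.
Hypothesis fieldR : GRing.field_axiom R.
Hypothesis const_int : forall c : R, integralOver phi c%:P%:F.

Lemma tofrac_constV (c : R) : c != 0 -> (c%:P%:F)^-1 = (c^-1)%:P%:F.
Proof.
move=> c0; apply: (mulfI (_ : c%:P%:F != 0)); first by rewrite tofrac_eq0 polyC_eq0.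
by rewrite divff ?tofrac_eq0 ?polyC_eq0 // -tofracM -polyCM divrr ?tofrac1 // fieldR.
Qed.

Lemma phi_neq0 b : b != 0 -> phi b != 0.
Proof. by rewrite -(inj_eq phi_inj) rmorph0. Qed.

Local Notation const := (@FracField.tofrac {poly R} \o polyC).

Lemma map_const_horner (p : {poly R}) : (map_poly const p).[x] = p%:F.
Proof. by rewrite map_poly_comp horner_map -[in RHS](comp_polyXr p). Qed.

Lemma const_inj : injective const.
Proof. by move=> a c /= /eqP; rewrite tofrac_eq => /eqP /polyC_inj. Qed.

Lemma size_const (p : {poly R}) : size (map_poly const p) = size p.
Proof. by apply: size_map_inj_poly; [apply: const_inj | apply: rmorph0]. Qed.

Lemma integral_of_poly_value (r : {poly R}) (v : {fraction {poly R}}) b :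
    (1 < size r)%N -> (map_poly const r).[v] = phi b ->
  integralOver phi v.
Proof.
move=> r_gt1 rv; apply: integral_of_nonconstant_value rv _ _.
- by rewrite size_const.
- by move=> i; rewrite coef_map; apply: const_int.
rewrite (lead_coef_map_inj const_inj (rmorph0 _)) /= tofrac_constV ?lead_coef_eq0 //.
by rewrite -size_poly_gt0 ltnW.
Qed.

(** If phi b = p x^k with k > 0, then phi b is the value at x of p X^k. *)
Lemma integral_X b : b != 0 -> 0 < lord (phi b) -> integralOver phi x.
Proof.
move=> /phi_neq0 /(nformP (phiL b)); rewrite /lord.
case: (nform _) => p k [/= p0 bE] k_gt0.
have [n [n_gt0 kn]] : exists n : nat, (0 < n)%N /\ k = n by exists `|k|%N; lia.
apply: (@integral_of_poly_value (p * 'X^n) _ b).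
  have : p != 0 by apply: contraNneq p0 => ->; rewrite coef0.
  by rewrite -size_poly_gt0 => p_gt0; rewrite size_mulXn -?size_poly_gt0 //; lia.
by rewrite map_const_horner bE kn tofracM tofracXn exprnP.
Qed.

(** If phi b = p x^-n with deg p < n, then phi b is the value at x^-1 of the
    degree n reversal of p. *)
Lemma integral_Xinv b : b != 0 -> ldeg (phi b) < 0 -> integralOver phi x^-1.
Proof.
move=> /phi_neq0 /(nformP (phiL b)).
case nfE: (nform _) => [p k] [/= p0 bE]; rewrite (ldegE nfE) => deg_lt0.
have [n [szp kn]] : exists n : nat, (size p <= n)%N /\ k = - n%:Z.
  by exists `|k|%N; lia.
have p_gt0 : (0 < size p)%N.
  by rewrite size_poly_gt0; apply: contraNneq p0 => ->; rewrite coef0.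
pose r := \poly_(i < n.+1) p`_(n - i).
have sz_r : size r = n.+1 by rewrite size_poly_eq // subnn.
apply: (@integral_of_poly_value r _ b); first by rewrite sz_r; lia.
rewrite (@horner_coef_wide _ n.+1); last by rewrite size_const sz_r.
rewrite bE kn -(map_const_horner p) (@horner_coef_wide _ n.+1); last first.
  by rewrite size_const; exact: leqW.
rewrite mulr_suml (reindex_inj rev_ord_inj) /=; apply: eq_bigr => i _.
have le_in : (i <= n)%N by rewrite -ltnS.
rewrite !coef_map coef_poly ltnS subSS leq_subr subKn // -mulrA.
case: i le_in => i /= _ le_in.
congr (_ * _); rewrite exprVn -exprnN -[in RHS](subnKC le_in).
have Xi0 : x ^+ i != 0 := expf_neq0 i fracX_neq0.
by rewrite [in RHS]exprD invfM (mulVKf Xi0).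
Qed.

(** The inverse of c x^k is a constant times a power of x or of x^-1, whichever
    the sign of k calls for. *)
Lemma monomial_unit b :
    b != 0 -> lwidth (phi b) = 0%N ->
    (0 < lord (phi b) -> integralOver phi x^-1) ->
    (lord (phi b) < 0 -> integralOver phi x) ->
  b \is a GRing.unit.
Proof.
move=> b0 w0 int_Xinv int_X; apply: (unit_of_integral_inverse phi_inj b0).
have [c c0 ->] := lwidth0_monomial (phiL b) (phi_neq0 b0) w0.
rewrite invfM tofrac_constV // invr_expz; apply: integral_mul => //.
have [ord_lt0 | ord_gt0 | ->] := ltgtP (lord (phi b)) 0.
- have -> : - lord (phi b) = `|lord (phi b)|%N by lia.
  exact/integral_exp/int_X.
- rewrite -invr_expz -{1}(gtz0_abs ord_gt0) -exprVn.
  exact/integral_exp/int_Xinv.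
by rewrite oppr0 expr0z; apply: integral1.
Qed.

Let deg_nonneg : Prop := forall a, a != 0 -> 0 <= ldeg (phi a).
Let ord_nonpos : Prop := forall a, a != 0 -> lord (phi a) <= 0.

(** The degree and the order are additive, and each is counted exactly when it has
    constant sign on D, so that its absolute value is additive too.  When the degree summand is absent,
    x^-1 is integral over D, so the monomials of positive degree, which it was
    meant to count, are units; likewise for the order. *)
Definition length_of b : nat :=
  (lwidth (phi b) + (if `[< deg_nonneg >] then `|ldeg (phi b)| else 0)
                  + (if `[< ord_nonpos >] then `|lord (phi b)| else 0))%N.

Lemma atomic_of_laurent_embedding : atomic D.
Proof.
apply: (@atomic_of_length D length_of).
  move=> a b a0 b0; have ab0 : a * b != 0 by rewrite mulf_neq0.
  have := (phi_neq0 a0, phi_neq0 b0) => -[fa0 fb0].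
  rewrite /length_of rmorphM (lwidthM (phiL a) (phiL b) fa0 fb0).
  rewrite (ldegM (phiL a) (phiL b) fa0 fb0) (lordM (phiL a) (phiL b) fa0 fb0).
  have [degP|_] := asboolP; have [ordP|_] := asboolP => /=.
  - by have := (degP a a0, degP b b0, ordP a a0, ordP b b0) => -[[[]]]; lia.
  - by have := (degP a a0, degP b b0) => -[]; lia.
  - by have := (ordP a a0, ordP b b0) => -[]; lia.
  - lia.
move=> b b0; rewrite /length_of => l0.
have w0 : lwidth (phi b) = 0%N by lia.
have dego : ldeg (phi b) = lord (phi b) by rewrite /ldeg w0 add0r.
apply: monomial_unit => // [ord_gt0 | ord_lt0].
  move: l0; case: asboolP => [_ | /existsNP[a /not_implyP[a0 /negP deg_a]] _]; first by lia.
  by apply: (integral_Xinv a0); rewrite ltNge.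
move: l0; case: (asboolP ord_nonpos) => [_ |]; first by lia.
move=> /existsNP[a /not_implyP[a0 /negP ord_a]] _.
by apply: (integral_X a0); rewrite ltNge.
Qed.

End IntegralConstants.

(** * Every subring of R is a field *)

Section FractionsSubring.
Variables (R : idomainType) (A : subringClosed R) (t : R).
Local Notation E := {fraction {poly R}}.
Local Notation "p %:F" := (@FracField.tofrac {poly R} p).
Local Notation x := ('X%:F : E).

Definition multiple_in (c : R) : Prop := exists2 a, a \in A & c = t * a.

Lemma multiple_in0 : multiple_in 0.
Proof. by exists 0; rewrite ?rpred0 ?mulr0. Qed.

Lemma multiple_inB c d : multiple_in c -> multiple_in d -> multiple_in (c - d).
Proof. by move=> [a aA ->] [b bA ->]; exists (a - b); rewrite ?rpredB ?mulrBr. Qed.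

Lemma multiple_inD c d : multiple_in c -> multiple_in d -> multiple_in (c + d).
Proof. by move=> [a aA ->] [b bA ->]; exists (a + b); rewrite ?rpredD ?mulrDr. Qed.

Lemma multiple_inM c d : multiple_in c -> d \in A -> multiple_in (c * d).
Proof. by move=> [a aA ->] dA; exists (a * d); rewrite ?rpredM ?mulrA. Qed.

(** p / x^n is a Laurent polynomial over A whose coefficients of negative degree
    are multiples of t; the pair (p, n) may be non-reduced, which makes sums and
    products easy to represent. *)
Definition polar_form (f : E) (p : {poly R}) (n : nat) : Prop :=
  [/\ p \is a polyOver A, forall i, (i < n)%N -> multiple_in p`_i
    & f = p%:F / ('X^n)%:F].

Definition polar_pred : {pred laurent R} :=
  fun f => `[< exists p n, polar_form (val f) p n >].

Fact polar_subring_closed : subring_closed polar_pred.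
Proof.
have Xn0 n : ('X^n)%:F != 0 :> E by rewrite tofrac_eq0 monic_neq0 ?monicXn.
have X_A : 'X \is a polyOver A by rewrite polyOverX.
split.
- apply/asboolP; exists 1, 0%N; split; rewrite ?rpred1 //.
  by rewrite expr0 divff ?tofrac_eq0 ?oner_eq0 //; exact: rmorph1.
- move=> f g /asboolP[p [m [pA pt fE]]] /asboolP[q [n [qA qt gE]]].
  apply/asboolP; exists (p * 'X^n - q * 'X^m), (m + n)%N; split.
  + by rewrite rpredB ?rpredM ?rpredX.
  + move=> i lt_i; rewrite coefB !coefMXn; apply: multiple_inB.
      by case: ltnP => le_i; [exact: multiple_in0 | apply: pt; lia].
    by case: ltnP => le_i; [exact: multiple_in0 | apply: qt; lia].
  + have -> : val (f - g) = val f - val g by exact: rmorphB.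
    rewrite fE gE exprD tofracB !tofracM -mulNr.
    by rewrite (addf_div _ _ (Xn0 m) (Xn0 n)) mulNr.
- move=> f g /asboolP[p [m [pA pt fE]]] /asboolP[q [n [qA qt gE]]].
  apply/asboolP; exists (p * q), (m + n)%N; split.
  + by rewrite rpredM.
  + move=> i lt_i; rewrite coefM; apply: (big_ind multiple_in).
    * exact: multiple_in0.
    * exact: multiple_inD.
    (* In degree i < m + n of p q, one of the factors p_j, q_(i-j) is polar. *)
    move=> [j /= lt_j] _; case: (ltnP j m) => le_j.
      by apply: multiple_inM; [apply: pt | apply: (polyOverP qA)].
    by rewrite mulrC; apply: multiple_inM; [apply: qt; lia | apply: (polyOverP pA)].
  + have -> : val (f * g) = val f * val g by exact: rmorphM.
    by rewrite fE ?gE exprD !tofracM mulf_div.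
Qed.

HB.instance Definition _ :=
  GRing.isSubringClosed.Build _ polar_pred polar_subring_closed.

(** The argument depends only on which Laurent polynomials lie in the ring, so
    the ring is any C with these elements. *)
Section Carrier.
Variable C : subringClosed (laurent R).
Hypothesis C_polar : C =i polar_pred.
Local Notation S := (subring C).

Lemma polar_lift f p n : polar_form f p n -> exists b : S, laurent_val b = f.
Proof.
move=> fpn; have fL : f \in @laurent_pred R.
  by apply/asboolP; exists p, n; case: fpn.
have bS : (Subring fL : laurent R) \in C.
  by rewrite C_polar; apply/asboolP; exists p, n.
by exists (Subring bS).
Qed.

Lemma polar_monomial (b : S) c k : laurent_val b = c%:P%:F * x ^ k ->
  c \in A /\ (k < 0 -> multiple_in c).
Proof.
have := valP b; rewrite C_polar => /asboolP[p [n [pA pt bE]]].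
have {bE}-> : laurent_val b = p%:F / ('X^n)%:F by exact: bE.
rewrite tofracXn => pE.
have {}pE : p%:F = c%:P%:F * x ^ (k + n%:Z).
  rewrite (expfzDr _ _ (fracX_neq0 R)) mulrA -pE -exprnP divfK //.
  by rewrite expf_neq0 // fracX_neq0.
case: (leP 0 (k + n%:Z)) => [kn_ge0 | kn_lt0].
  have [m kn] : exists m : nat, k + n%:Z = m by exists `|(k + n%:Z)%R|%N; lia.
  move: pE; rewrite kn -exprnP -tofracXn -tofracM => /eqP.
  rewrite tofrac_eq => /eqP pE; have <- : p`_m = c.
    by rewrite pE coefMXn ltnn subnn coefC.
  by split=> [|k_lt0]; [apply: (polyOverP pA) | apply: pt; lia].
have [m kn] : exists m : nat, k + n%:Z = - m.+1%:Z.
  by exists `|(k + n%:Z)%R|.-1%N; lia.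
have /eqP : (p * 'X^(m.+1))%:F = c%:P%:F.
  rewrite tofracM pE kn tofracXn -exprnN mulfVK //.
  by rewrite expf_neq0 // fracX_neq0.
rewrite tofrac_eq => /eqP /(congr1 (fun q : {poly R} => q`_0)).
rewrite coefMXn coefC /= => <-.
by split=> [|_]; [apply: rpred0 | apply: multiple_in0].
Qed.

(** A unit of the ring is a monomial d x^k, with inverse d^-1 x^-k.  One of the
    two has negative degree, so d or d^-1 is a multiple of t in A, and so is
    d d^-1 = 1. *)
Lemma polar_unit_order (b c : S) : b * c = 1 -> lord (laurent_val b) != 0 ->
  exists2 u, u \in A & t * u = 1.
Proof.
move=> bc1; have bc0 : b * c != 0 by rewrite bc1 oner_eq0.
have [b0 c0] : b != 0 /\ c != 0 by apply/andP; rewrite -negb_or -mulf_eq0.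
have := (laurent_val_neq0 b0, laurent_val_neq0 c0) => -[fb0 fc0].
have [bL cL] := (laurent_val_laurent b, laurent_val_laurent c).
have nf1 : nform (laurent_val b * laurent_val c) = (1, 0).
  rewrite -laurent_valM bc1 laurent_val1; apply: nform_eq.
  by split; rewrite /= ?coef1 ?oner_eq0 // expr0z mulr1; exact: esym (tofrac1 _).
have := lordM bL cL fb0 fc0; rewrite {1}/lord nf1 /= => ord0.
have := lwidthM bL cL fb0 fc0; rewrite {1}/lwidth nf1 size_poly1 /= => width0.
have [|d _ bE] := lwidth0_monomial bL fb0; first by lia.
have [|e _ cE] := lwidth0_monomial cL fc0; first by lia.
have [[dA dt] [eA et]] := (polar_monomial bE, polar_monomial cE).
have de1 : d * e = 1.
  have := congr1 (@laurent_val _ C) bc1; rewrite laurent_valM laurent_val1 bE cE mulrACA.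
  rewrite -(expfzDr _ _ (fracX_neq0 R)) -ord0 expr0z mulr1 -tofracM -polyCM -tofrac1.
  by move=> /eqP; rewrite tofrac_eq -polyC1 => /eqP /polyC_inj.
rewrite neq_lt => /orP[ord_lt0 | ord_gt0].
  have [a aA da] := dt ord_lt0; exists (a * e); first exact: rpredM.
  by rewrite mulrA -da.
have /et[a aA ea] : lord (laurent_val c) < 0 by lia.
exists (a * d); first exact: rpredM.
by rewrite mulrA -ea mulrC.
Qed.

(** Width and order are additive, and the width is nonnegative. *)
Lemma factor_negative_order (s : seq S) :
    (forall b, b \in s -> b != 0) ->
    lwidth (laurent_val (\prod_(b <- s) b)) = 0%N ->
    lord (laurent_val (\prod_(b <- s) b)) < 0 ->
  exists2 b, b \in s &
    lwidth (laurent_val b) = 0%N /\ lord (laurent_val b) < 0.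
Proof.
elim: s => [|b s IHs] s0.
  rewrite big_nil laurent_val1 /lord (@nform_eq _ _ (1, 0)) //.
  by split; rewrite /= ?coef1 ?oner_eq0 // expr0z mulr1; exact: esym (tofrac1 _).
have b0 : b != 0 by rewrite s0 ?mem_head.
have {}s0 c : c \in s -> c != 0 by move=> sc; rewrite s0 // inE sc orbT.
have ps0 : \prod_(c <- s) c != 0.
  by rewrite prodf_seq_neq0; apply/allP=> c /s0.
rewrite big_cons laurent_valM.
have fb0 := laurent_val_neq0 b0; have fs0 := laurent_val_neq0 ps0.
have [bL sL] := (laurent_val_laurent b, laurent_val_laurent (\prod_(c <- s) c)).
rewrite (lwidthM bL sL fb0 fs0) (lordM bL sL fb0 fs0) => width0 ord_lt0.
case: (ltP (lord (laurent_val b)) 0) => ord_b.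
  by exists b; [exact: mem_head | lia].
have [||c sc cP] := IHs s0; [by lia | by lia |].
by exists c; rewrite // inE sc orbT.
Qed.

(** The element without a factorization is t x^-1: one of its irreducible factors
    would be a monomial of negative degree, from which x can be split off. *)
Lemma polar_nonatomic : t \in A -> t != 0 -> atomic S ->
  exists2 u, u \in A & t * u = 1.
Proof.
move=> tA t0 atomS; apply: contrapT => noU.
have monomial c n : c != 0 -> multiple_in c -> c \in A ->
    exists b : S, laurent_val b = c%:P%:F * x ^ (- n%:Z).
  move=> c0 ct cA; apply: (@polar_lift _ c%:P n).
  split; first by rewrite polyOverC.
    by move=> i _; rewrite coefC; case: ifP => // _; apply: multiple_in0.
  by rewrite tofracXn -exprnN.
have t_t : multiple_in t by exists 1; rewrite ?rpred1 ?mulr1.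
have nf_monomial c k : c != 0 -> nform (c%:P%:F * x ^ k) = (c%:P, k).
  by move=> c0; apply: nform_eq; split; rewrite //= coefC.
have nz c k (b : S) : c != 0 -> laurent_val b = c%:P%:F * x ^ k -> b != 0.
  move=> c0 bE; apply: contra_eq_neq bE => ->.
  rewrite eq_sym mulf_neq0 ?tofrac_eq0 ?polyC_eq0 //.
  by rewrite expfz_neq0 // fracX_neq0.
have [X XE] : exists b : S, laurent_val b = x.
  apply: (@polar_lift _ 'X 0); split=> //; first by rewrite polyOverX.
  by rewrite expr0 tofrac1 divr1.
have ordX : lord (laurent_val X) = 1.
  have xE : x = 1%:P%:F * x ^ 1 by rewrite polyC1 tofrac1 mul1r expr1z.
  by rewrite XE xE /lord nf_monomial ?oner_eq0.
have X_NU b : X * b != 1.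
  by apply: contra_notN noU => /eqP /polar_unit_order; apply; rewrite ordX.
have [y yE] := monomial t 1%N t0 t_t tA.
have yNU : y \isn't a GRing.unit.
  apply: contra_notN noU => /unitrP[z [_ /polar_unit_order]]; apply.
  by rewrite yE /lord nf_monomial.
have [s irr_s ys] := atomS y (nz _ _ _ t0 yE) yNU.
have [||| b sb [width0 ord_lt0]] := @factor_negative_order s.
- by move=> b /irr_s[].
- by rewrite -ys yE /lwidth nf_monomial //= size_polyC t0.
- by rewrite -ys yE /lord nf_monomial.
have [b0 _ irr_b] := irr_s b sb.
have [c c0 bE] := lwidth0_monomial (laurent_val_laurent b) (laurent_val_neq0 b0) width0.
have [cA /(_ ord_lt0) ct] := polar_monomial bE.
have [n ordb] : exists n : nat, lord (laurent_val b) = - n%:Z.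
  by exists `|lord (laurent_val b)|%N; lia.
have [b' b'E] := monomial c n.+1 c0 ct cA.
have /irr_b[] : b = X * b'.
- apply: laurent_val_inj; rewrite laurent_valM bE XE b'E mulrCA; congr (_ * _).
  have -> : lord (laurent_val b) = 1 + - n.+1%:Z by lia.
  by rewrite (expfzDr _ _ (fracX_neq0 R)) expr1z.
- by move=> /unitrP[z [_ /eqP Xz1]]; move: (X_NU z); rewrite Xz1.
move=> /unitrP[z [_ /polar_unit_order]] H; apply/noU/H.
by rewrite b'E /lord nf_monomial.
Qed.

End Carrier.

End FractionsSubring.

Lemma laurent_hered_atomic_inverse (R : idomainType) (A : subringClosed R) t :
  hereditarily_atomic (laurent R) -> t \in A -> t != 0 ->
  exists2 u, u \in A & t * u = 1.
Proof.
move=> hatom tA t0.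
by apply: (@polar_nonatomic _ A t (polar_pred A t) _ tA t0 (hatom _)) => f.
Qed.

(** * The two implications *)

(** The coefficients of an equation over F_p are images of natural numbers, hence
    integral over any ring. *)
Lemma integral_of_algebraic (D R K : comNzRingType) (p : nat)
    (phi : {rmorphism D -> K}) (psi : {rmorphism R -> K})
    (iota : {rmorphism 'F_p -> R}) (a : R) (q : {poly 'F_p}) :
  q != 0 -> root (map_poly iota q) a -> integralOver phi (psi a).
Proof.
move=> q0 qa; pose q1 := (lead_coef q)^-1 *: q.
have q1_mon : q1 \is monic by rewrite monicE lead_coefZ mulVf ?lead_coef_eq0.
apply: (@integral_root_monic _ _ phi _ (map_poly (psi \o iota) q1)).
- exact: monic_map.
- rewrite map_poly_comp /root horner_map map_polyZ hornerZ (rootP qa).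
  by rewrite mulr0 rmorph0.
apply/integral_poly=> i; rewrite coef_map -[q1`_i]natr_Zp /= !rmorph_nat.
exact: integral_nat.
Qed.

Lemma hered_atomic_of_algebraic (R : idomainType) (p : nat) :
  algebraic_extension_Fp R p -> hereditarily_atomic (laurent R).
Proof.
move=> [fieldR [iota alg]] S.
apply: (@atomic_of_laurent_embedding R _ (@laurent_val R S)) => //.
- exact: laurent_val_inj.
- exact: laurent_val_laurent.
move=> c; have [q q0 qc] := alg c.
exact: (@integral_of_algebraic _ _ _ p _ (@FracField.tofrac {poly R} \o polyC)
  _ _ _ q0 qc).
Qed.

Section IntegerAdjoin.
Variables (R : idomainType) (a : R).

Definition int_adjoin : {pred R} :=
  fun c => `[< exists q : {poly int}, c = (map_poly intr q).[a] >].

Fact int_adjoin_subring_closed : subring_closed int_adjoin.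
Proof.
split.
- by apply/asboolP; exists 1; rewrite rmorph1 hornerC.
- move=> _ _ /asboolP[q ->] /asboolP[r ->]; apply/asboolP.
  by exists (q - r); rewrite rmorphB hornerD hornerN.
- move=> _ _ /asboolP[q ->] /asboolP[r ->]; apply/asboolP.
  by exists (q * r); rewrite rmorphM hornerM.
Qed.

HB.instance Definition _ :=
  GRing.isSubringClosed.Build _ int_adjoin int_adjoin_subring_closed.

End IntegerAdjoin.

(** If 2 is not zero in R, an inverse of 2 in Z.1 gives 2 m - 1 = 0 in R for some
    integer m, and 2 m - 1 is not zero in Z. *)
Lemma pchar_of_hered_atomic (R : idomainType) :
  hereditarily_atomic (laurent R) -> exists p : nat, p \in [pchar R].
Proof.
move=> hatom; have [two0 | two0] := eqVneq (2%:R : R) 0.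
  by apply: (@natf0_pchar _ 2) => //; apply/eqP.
have [||u /asboolP[q ->] two_u] :=
  @laurent_hered_atomic_inverse R (int_adjoin 0) 2%:R hatom.
- by rewrite rpred_nat.
- exact: two0.
have q0E : (map_poly intr q).[0] = (q`_0)%:~R :> R.
  by rewrite horner_coef0 coef_map.
pose z : int := 2 * q`_0 - 1.
have rel : z%:~R = 0 :> R by rewrite rmorphB rmorphM /= -q0E two_u subrr.
have z0 : (0 < `|z|)%N by lia.
apply: natf0_pchar z0 _; case: z rel => n; first by move/eqP.
by rewrite NegzE mulrNz => /eqP; rewrite oppr_eq0.
Qed.

(** If a q(a) = 1 with q over Z, then a is a root of X q - 1 modulo p, which is
    nonzero because its constant coefficient is -1. *)
Lemma algebraic_of_hered_atomic (R : idomainType) (p : nat) :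
  p \in [pchar R] -> hereditarily_atomic (laurent R) ->
  algebraic_extension_Fp R p.
Proof.
move=> charRp hatom.
have inv (a : R) : a != 0 -> exists q : {poly int}, a * (map_poly intr q).[a] = 1.
  move=> a0; have [||u /asboolP[q ->]] :=
    @laurent_hered_atomic_inverse R (int_adjoin a) a hatom.
  - by apply/asboolP; exists 'X; rewrite map_polyX hornerX.
  - exact: a0.
  by exists q.
split=> [a /inv[q aq1] | ].
  by apply/unitrP; exists (map_poly intr q).[a]; rewrite mulrC aq1.
pose iota0 : {rmorphism 'F_p -> pPrimeCharType charRp} := in_alg _.
have iota : {rmorphism 'F_p -> R} by exact: iota0.
exists iota => a; have [-> | a0] := eqVneq a 0.
  by exists 'X; rewrite ?polyX_eq0 // map_polyX rootX.
have [q aq1] := inv a a0; exists ('X * map_poly intr q - 1).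
  apply: contraTneq (oner_neq0 'F_p) => /(congr1 (fun r => r.[0])).
  rewrite hornerD hornerN hornerM hornerX !hornerC mul0r sub0r => /eqP.
  by rewrite oppr_eq0.
rewrite rmorphB rmorphM rmorph1 /= map_polyX -map_poly_comp /root.
rewrite hornerD hornerN hornerM hornerX hornerC.
rewrite (eq_map_poly (g := intr)) ?aq1 ?subrr // => n.
exact: rmorph_int.
Qed.

Theorem theorem5p10 (R : idomainType) :
  hereditarily_atomic (laurent R) <->
  exists2 p : nat, prime p & algebraic_extension_Fp R p.
Proof.
split=> [hatom | [p _]]; last exact: hered_atomic_of_algebraic.
have [p charRp] := pchar_of_hered_atomic hatom.
by exists p; [apply: pcharf_prime charRp | apply: algebraic_of_hered_atomic].
Qed.
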